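(* Let $d,n\geq 1$ be integers. Then ${\rm Spec}_{\rm JM}\subseteq {\rm Cont}_d(n)$; that is, every array in the spectrum of the Jucys--Murphy elements $t_1,\dots,t_n,J_1,\dots,J_n$ of the Yokonuma--Hecke algebra ${\rm Y}_{d,n}(q)$ is a content array.
   Context: Let $q$ be an indeterminate. The Yokonuma--Hecke algebra ${\rm Y}_{d,n}(q)$ is the associative unital $\mathbb{C}[q,q^{-1}]$-algebra generated by $g_1,\dots,g_{n-1},t_1,\dots,t_n$ subject to: $g_ig_j=g_jg_i$ for $|i-j|>1$; $g_ig_{i+1}g_i=g_{i+1}g_ig_{i+1}$ for $i=1,\dots,n-2$; $t_it_j=t_jt_i$ for all $i,j$; $t_jg_i=g_it_{s_i(j)}$ for all $i,j$, where $s_i$ is the transposition $(i,i+1)$; $t_j^d=1$ for all $j$; and $g_i^2=1+(q-q^{-1})e_ig_i$ for all $i$, where $e_i=\frac1d\sum_{s=0}^{d-1}t_i^st_{i+1}^{-s}$. Write $\mathbb{C}(q){\rm Y}_{d,n}(q)=\mathbb{C}(q)\otimes_{\mathbb{C}[q,q^{-1}]}{\rm Y}_{d,n}(q)$. The Jucys--Murphy elements are $t_1,\dots,t_n$ together with $J_1:=1$, $J_{i+1}:=g_iJ_ig_i$ for $i=1,\dots,n-1$. Spectrum. Consider representations of $\mathbb{C}(q){\rm Y}_{d,n}(q)$ satisfying: (i) $t_1,\dots,t_n,J_1,\dots,J_n$ are represented by diagonalisable operators; (ii) for every $i=1,\dots,n-1$, the action of the subalgebra of $\mathbb{C}(q){\rm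 Y}_{d,n}(q)$ generated by $t_i,t_{i+1},J_i,J_{i+1},g_i$ is completely reducible. A $2\times n$ array $\Lambda=\begin{pmatrix}\mathsf{a}_1,\dots,\mathsf{a}_n\\ \mathsf{c}_1,\dots,\mathsf{c}_n\end{pmatrix}$ with entries in $\mathbb{C}(q)$ belongs to ${\rm Spec}_{\rm JM}$ if there exist a representation $V_\Lambda$ satisfying (i) and (ii) and a nonzero vector $\mathbf{v}_\Lambda\in V_\Lambda$ with $t_i(\mathbf{v}_\Lambda)=\mathsf{a}_i\mathbf{v}_\Lambda$ and $J_i(\mathbf{v}_\Lambda)=\mathsf{c}_i\mathbf{v}_\Lambda$ for $i=1,\dots,n$. Content arrays. ${\rm Cont}_d(n)$ is the set of $2\times n$ arrays $\begin{pmatrix}\mathsf{a}_1,\dots,\mathsf{a}_n\\ \mathsf{c}_1,\dots,\mathsf{c}_n\end{pmatrix}$ with entries in $\mathbb{C}(q)$ such that: (1) $\mathsf{c}_1=1$ and $\mathsf{a}_i^d=1$ for all $i=1,\dots,n$; (2) if $\mathsf{c}_j\neq1$ for some $j>1$, then there exists $i<j$ with $\mathsf{a}_i=\mathsf{a}_j$ and $\mathsf{c}_i\in\{\mathsf{c}_jq^{-2},\mathsf{c}_jq^2\}$; (3) if $\mathsf{a}_j=\mathsf{a}_k$ and $\mathsf{c}_j=\mathsf{c}_k$ for $j<k$, then $k-j\geq3$ and there exist $j+1\leq i_1,i_2\leq k-1$ with $\mathsf{a}_{i_1}=\mathsf{a}_{i_2}=\mathsf{a}_j$, $\mathsf{c}_{i_1}=\mathsf{c}_jq^{-2}$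 and $\mathsf{c}_{i_2}=\mathsf{c}_jq^2$. *)

(* Defs.v *)
From HB Require Import structures.
From mathcomp Require Import all_boot all_order perm all_algebra.
From mathcomp Require Import boolp classical_sets reals.
From mathcomp Require Import complex.

Set Implicit Arguments.
Unset Strict Implicit.
Unset Printing Implicit Defensive.

Import GRing.Theory.
Local Open Scope ring_scope.
Local Open Scope quotient_scope.

Fact ltn_ordS (n : nat) (i : 'I_n.-1) : (i.+1 < n)%N.
Proof. by rewrite -ltn_predRL. Qed.

(* With 0-based indices, the simple transposition number [i : 'I_n.-1]
   exchanges [pos i] and [posS i]. *)
Definition pos (n : nat) (i : 'I_n.-1) : 'I_n := widen_ord (leq_pred n) i.
Definition posS (n : nat) (i : 'I_n.-1) : 'I_n := Ordinal (ltn_ordS i).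

Section YokonumaHecke.
Variables (K : fieldType) (q : K) (d n : nat).

Section Relations.
Variables (A : algType K) (t : 'I_n -> A) (g : 'I_n.-1 -> A).

(* As [t j ^+ d = 1], the negative power [t j ^ (- s)] is [t j ^+ (d - s)]
   for [s < d]. *)
Definition idem_e (i : 'I_n.-1) : A :=
  d%:R^-1 *: \sum_(s < d) t (pos i) ^+ s * t (posS i) ^+ (d - s).

Record YH_relations : Prop := YHRelations {
  YH_gC : forall i j : 'I_n.-1, (i.+1 < j)%N || (j.+1 < i)%N ->
    g i * g j = g j * g i;
  YH_braid : forall i j : 'I_n.-1, j = i.+1 :> nat ->
    g i * g j * g i = g j * g i * g j;
  YH_tC : forall i j : 'I_n, t i * t j = t j * t i;
  YH_tg : forall (j : 'I_n) (i : 'I_n.-1),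
    t j * g i = g i * t (tperm (pos i) (posS i) j);
  YH_tX : forall j : 'I_n, t j ^+ d = 1;
  YH_gX2 : forall i : 'I_n.-1, g i ^+ 2 = 1 + (q - q^-1) *: (idem_e i * g i)
}.

End Relations.

Inductive YHterm : Type :=
| YHscal of K
| YHtgen of 'I_n
| YHggen of 'I_n.-1
| YHadd of YHterm & YHterm
| YHmul of YHterm & YHterm.

HB.instance Definition _ := gen_eqMixin YHterm.
HB.instance Definition _ := gen_choiceMixin YHterm.

Fixpoint YHeval (A : algType K) (t : 'I_n -> A) (g : 'I_n.-1 -> A)
    (x : YHterm) : A :=
  match x with
  | YHscal c => c%:A
  | YHtgen i => t i
  | YHggen i => g i
  | YHadd x y => YHeval t g x + YHeval t g y
  | YHmul x y => YHeval t g x * YHeval t g y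
  end.

(* The algebra presented by the relations is the quotient of noncommutative
   polynomial expressions by the identities that hold whenever the relations
   do; [YH_gen_relations] and [YH_universal] below give its universal
   property. *)
Definition YHequiv (x y : YHterm) : bool :=
  `[< forall (A : algType K) (t : 'I_n -> A) (g : 'I_n.-1 -> A),
      YH_relations t g -> YHeval t g x = YHeval t g y >].

Fact YHequivP x y : reflect
  (forall (A : algType K) (t : 'I_n -> A) (g : 'I_n.-1 -> A),
      YH_relations t g -> YHeval t g x = YHeval t g y) (YHequiv x y).
Proof. exact: asboolP. Qed.

Fact YHequiv_refl : reflexive YHequiv.
Proof. by move=> x; apply/YHequivP. Qed.

Fact YHequiv_sym : symmetric YHequiv.
Proof. by move=> x y; apply/YHequivP/YHequivP => h A t g r; rewrite h. Qed.

Fact YHequiv_trans : transitive YHequiv.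
Proof.
by move=> y x z /YHequivP h1 /YHequivP h2; apply/YHequivP => A t g r;
  rewrite h1 ?h2.
Qed.

Canonical YHequiv_equiv := EquivRel YHequiv YHequiv_refl YHequiv_sym YHequiv_trans.

Definition YH := {eq_quot YHequiv}.
HB.instance Definition _ := Choice.on YH.
HB.instance Definition _ : EqQuotient _ YHequiv YH := EqQuotient.on YH.

Fact YH_eqP x y : reflect
  (forall (A : algType K) (t : 'I_n -> A) (g : 'I_n.-1 -> A),
      YH_relations t g -> YHeval t g x = YHeval t g y)
  (\pi_YH x == \pi_YH y).
Proof. by rewrite eqmodE; exact: YHequivP. Qed.

Definition YHlift (A : algType K) (t : 'I_n -> A) (g : 'I_n.-1 -> A)
  (x : YH) : A := YHeval t g (repr x).

Fact YHlift_pi (A : algType K) (t : 'I_n -> A) (g : 'I_n.-1 -> A) x :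
  YH_relations t g -> YHlift t g (\pi_YH x) = YHeval t g x.
Proof.
by move=> r; rewrite /YHlift; apply: (elimT (YH_eqP _ _)) r; rewrite reprK.
Qed.

Definition YH_zero : YH := \pi_YH (YHscal 0).
Definition YH_one : YH := \pi_YH (YHscal 1).
Definition YH_add (x y : YH) : YH := \pi_YH (YHadd (repr x) (repr y)).
Definition YH_mul (x y : YH) : YH := \pi_YH (YHmul (repr x) (repr y)).
Definition YH_scale (c : K) (x : YH) : YH := \pi_YH (YHmul (YHscal c) (repr x)).
Definition YH_opp (x : YH) : YH := YH_scale (-1) x.

Fact YH_ext (x y : YH) :
  (forall (A : algType K) (t : 'I_n -> A) (g : 'I_n.-1 -> A),
      YH_relations t g -> YHlift t g x = YHlift t g y) -> x = y.
Proof. by move=> h; rewrite -[x]reprK -[y]reprK; apply/eqP/YH_eqP. Qed.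

Section LiftE.
Variables (A : algType K) (t : 'I_n -> A) (g : 'I_n.-1 -> A).
Hypothesis r : YH_relations t g.

Fact YHlift0 : YHlift t g YH_zero = 0.
Proof. by rewrite YHlift_pi //= scale0r. Qed.
Fact YHlift1 : YHlift t g YH_one = 1.
Proof. by rewrite YHlift_pi //= scale1r. Qed.
Fact YHliftD x y : YHlift t g (YH_add x y) = YHlift t g x + YHlift t g y.
Proof. by rewrite YHlift_pi. Qed.
Fact YHliftM x y : YHlift t g (YH_mul x y) = YHlift t g x * YHlift t g y.
Proof. by rewrite YHlift_pi. Qed.
Fact YHliftZ c x : YHlift t g (YH_scale c x) = c *: YHlift t g x.
Proof. by rewrite YHlift_pi //= -scalerAl mul1r. Qed.
Fact YHliftN x : YHlift t g (YH_opp x) = - YHlift t g x.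
Proof. by rewrite YHliftZ scaleN1r. Qed.

Definition YHliftE := (YHlift0, YHlift1, YHliftN, YHliftD, YHliftM, YHliftZ).
End LiftE.

Fact YH_addA : associative YH_add.
Proof. by move=> x y z; apply: YH_ext => A t g r; rewrite !YHliftE // addrA. Qed.
Fact YH_addC : commutative YH_add.
Proof. by move=> x y; apply: YH_ext => A t g r; rewrite !YHliftE // addrC. Qed.
Fact YH_add0 : left_id YH_zero YH_add.
Proof. by move=> x; apply: YH_ext => A t g r; rewrite !YHliftE // add0r. Qed.
Fact YH_addN : left_inverse YH_zero YH_opp YH_add.
Proof. by move=> x; apply: YH_ext => A t g r; rewrite !YHliftE // addNr. Qed.

HB.instance Definition _ := GRing.isZmodule.Build YH YH_addA YH_addC YH_add0 YH_addN.

Fact YH_mulA : associative YH_mul.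
Proof. by move=> x y z; apply: YH_ext => A t g r; rewrite !YHliftE // mulrA. Qed.
Fact YH_mul1 : left_id YH_one YH_mul.
Proof. by move=> x; apply: YH_ext => A t g r; rewrite !YHliftE // mul1r. Qed.
Fact YH_1mul : right_id YH_one YH_mul.
Proof. by move=> x; apply: YH_ext => A t g r; rewrite !YHliftE // mulr1. Qed.
Fact YH_mulDl : left_distributive YH_mul YH_add.
Proof. by move=> x y z; apply: YH_ext => A t g r; rewrite !YHliftE // mulrDl. Qed.
Fact YH_mulDr : right_distributive YH_mul YH_add.
Proof. by move=> x y z; apply: YH_ext => A t g r; rewrite !YHliftE // mulrDr. Qed.

(* Nontriviality: [t j] acts by 1 and [g i] by q on the trivial module; the
   degenerate parameters (q = 0 or d = 0 in K) are sent to [g i = 1]. *)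
Fact YH_one_neq0 : YH_one != YH_zero.
Proof.
pose c : K := if (d%:R == 0 :> K) || (q == 0) then 1 else q.
have r : @YH_relations K^o (fun=> 1) (fun=> c).
  split=> [i j _|i j _|i j|j i|j|i] //.
  - by rewrite mul1r mulr1.
  - by rewrite expr1n.
  rewrite /idem_e (eq_bigr (fun=> 1)) => [|s _]; last by rewrite !expr1n mulr1.
  rewrite sumr_const card_ord /GRing.scale /=.
  rewrite /c; case: eqP => [->|/eqP d0] /=; first by rewrite !(mulr0, mul0r, addr0) expr1n.
  rewrite mulVf // mul1r; case: eqP => [->|/eqP q0].
    by rewrite invr0 subrr mul0r addr0 expr1n.
  by rewrite mulrBl mulVf // addrC subrK.
apply/eqP => /(congr1 (@YHlift K^o (fun=> 1) (fun=> c))).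
by rewrite !YHliftE //; apply/eqP/oner_neq0.
Qed.

HB.instance Definition _ := GRing.Zmodule_isNzRing.Build YH
  YH_mulA YH_mul1 YH_1mul YH_mulDl YH_mulDr YH_one_neq0.

Fact YH_scaleA a b v : YH_scale a (YH_scale b v) = YH_scale (a * b) v.
Proof. by apply: YH_ext => A t g r; rewrite !YHliftE // scalerA. Qed.
Fact YH_scale1 : left_id 1 YH_scale.
Proof. by move=> v; apply: YH_ext => A t g r; rewrite !YHliftE // scale1r. Qed.
Fact YH_scaleDr : right_distributive YH_scale +%R.
Proof. by move=> a u v; apply: YH_ext => A t g r; rewrite !YHliftE // scalerDr. Qed.
Fact YH_scaleDl v : {morph YH_scale^~ v : a b / a + b}.
Proof. by move=> a b; apply: YH_ext => A t g r; rewrite !YHliftE // scalerDl. Qed.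

HB.instance Definition _ := GRing.Zmodule_isLmodule.Build K YH
  YH_scaleA YH_scale1 YH_scaleDr YH_scaleDl.

Fact YH_scaleAl (a : K) (u v : YH) : a *: (u * v) = (a *: u) * v.
Proof. by apply: YH_ext => A t g r; rewrite !YHliftE // scalerAl. Qed.
HB.instance Definition _ := GRing.Lmodule_isLalgebra.Build K YH YH_scaleAl.

Fact YH_scaleAr (a : K) (u v : YH) : a *: (u * v) = u * (a *: v).
Proof. by apply: YH_ext => A t g r; rewrite !YHliftE // scalerAr. Qed.
HB.instance Definition _ := GRing.Lalgebra_isAlgebra.Build K YH YH_scaleAr.

Definition YHt (i : 'I_n) : YH := \pi_YH (YHtgen i).
Definition YHg (i : 'I_n.-1) : YH := \pi_YH (YHggen i).

(* [JM k] is the Jucys-Murphy element J_(k+1), for k < n. The default branch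
   is only reached for k >= n. *)
Fixpoint JM (k : nat) : YH :=
  if k is k'.+1 then
    if insub k' is Some i then YHg i * JM k' * YHg i else 1
  else 1.

Fact JM_S (i : 'I_n.-1) : JM i.+1 = YHg i * JM i * YHg i.
Proof. by rewrite /= valK. Qed.

Section LiftMorphism.
Variables (A : algType K) (t : 'I_n -> A) (g : 'I_n.-1 -> A).
Hypothesis r : YH_relations t g.

Fact YHlift_rmod (x y : YH) : YHlift t g (x + y) = YHlift t g x + YHlift t g y.
Proof. exact: YHliftD. Qed.
Fact YHlift_rmul (x y : YH) : YHlift t g (x * y) = YHlift t g x * YHlift t g y.
Proof. exact: YHliftM. Qed.
Fact YHlift_rone : YHlift t g 1 = 1. Proof. exact: YHlift1. Qed.
Fact YHlift_rscale c (x : YH) : YHlift t g (c *: x) = c *: YHlift t g x.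
Proof. exact: YHliftZ. Qed.
Fact YHlift_rzero : YHlift t g 0 = 0. Proof. exact: YHlift0. Qed.
Fact YHlift_rexp (x : YH) k : YHlift t g (x ^+ k) = YHlift t g x ^+ k.
Proof. by elim: k => [|k IH]; rewrite ?YHlift_rone // !exprS YHlift_rmul IH. Qed.
Fact YHlift_t i : YHlift t g (YHt i) = t i. Proof. by rewrite YHlift_pi. Qed.
Fact YHlift_g i : YHlift t g (YHg i) = g i. Proof. by rewrite YHlift_pi. Qed.
Fact YHlift_e i : YHlift t g (idem_e YHt i) = idem_e t i.
Proof.
rewrite YHlift_rscale; congr (_ *: _).
rewrite (big_morph _ YHlift_rmod YHlift_rzero); apply: eq_bigr => s _.
by rewrite YHlift_rmul !YHlift_rexp !YHlift_t.
Qed.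
End LiftMorphism.

Fact YH_gen_relations : YH_relations YHt YHg.
Proof.
split=> [i j h|i j h|i j|j i|j|i]; apply: YH_ext => A t g r;
  rewrite ?(YHlift_rexp, YHlift_rmul, YHlift_rmod, YHlift_rone, YHlift_rscale,
  YHlift_t, YHlift_g, YHlift_e) //.
- exact: (YH_gC r h).
- exact: (YH_braid r h).
- exact: (YH_tC r).
- exact: (YH_tg r).
- exact: (YH_tX r).
- exact: (YH_gX2 r).
Qed.

Fact YH_pi (x : YHterm) : YHeval YHt YHg x = \pi_YH x.
Proof.
elim: x => [c|i|i|x IHx y IHy|x IHx y IHy] //=.
- apply: YH_ext => A t g r.
  by rewrite YHlift_rscale // YHlift_rone // YHlift_pi.
- rewrite IHx IHy; apply: YH_ext => A t g r.
  by rewrite YHlift_rmod // !YHlift_pi.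
- rewrite IHx IHy; apply: YH_ext => A t g r.
  by rewrite YHlift_rmul // !YHlift_pi.
Qed.

Theorem YH_universal (A : algType K) (t : 'I_n -> A) (g : 'I_n.-1 -> A) :
  YH_relations t g ->
  exists2 f : {lrmorphism YH -> A},
    (forall i, f (YHt i) = t i) /\ (forall i, f (YHg i) = g i) &
    forall h : {lrmorphism YH -> A},
      (forall i, h (YHt i) = t i) -> (forall i, h (YHg i) = g i) -> h =1 f.
Proof.
move=> r.
have fL : linear (YHlift t g).
  by move=> c x y; rewrite YHlift_rmod // YHlift_rscale.
have fM : monoid_morphism (YHlift t g).
  by split=> [|x y]; [exact: YHlift_rone | exact: YHlift_rmul].
pose m1 := GRing.isLinear.Build _ _ _ _ (YHlift t g) fL.
pose m2 := GRing.isMonoidMorphism.Build _ _ (YHlift t g) fM.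
pose f : {lrmorphism YH -> A} := HB.pack (YHlift t g) m1 m2.
exists f; first by split=> i /=; rewrite ?YHlift_t ?YHlift_g.
move=> h ht hg x; rewrite -[x]reprK /= YHlift_pi // -YH_pi.
elim: (repr x) => [c|i|i|y IHy z IHz|y IHy z IHz] //=.
- by rewrite linearZ rmorph1.
- by rewrite rmorphD; congr (_ + _).
- by rewrite rmorphM; congr (_ * _).
Qed.

End YokonumaHecke.

Section Representations.
Variables (K : fieldType) (A : algType K) (V : lmodType K).

Record representation := Representation {
  act :> A -> {linear V -> V};
  act_linear : forall (c : K) (x y : A) (v : V),
    act (c *: x + y) v = c *: act x v + act y v;
  act1 : forall v : V, act 1 v = v;
  actM : forall (x y : A) (v : V), act (x * y) v = act x (act y v)
}.

(* V, possibly infinite-dimensional, is the (automatically direct) sum of the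
   eigenspaces of f. *)
Definition diagonalisable (f : V -> V) : Prop :=
  forall v : V, exists2 s : seq (K * V),
    {in s, forall p, f p.2 = p.1 *: p.2} & v = \sum_(p <- s) p.2.

Definition generated_subalg (S : seq A) (x : A) : Prop :=
  forall B : {pred A}, GRing.subalg_closed B -> {subset S <= B} -> x \in B.

Definition subrep (rho : representation) (B : A -> Prop) (W : {pred V}) : Prop :=
  GRing.submod_closed W /\
  forall x, B x -> forall w, w \in W -> rho x w \in W.

(* Every B-stable subspace has a B-stable complement. *)
Definition completely_reducible (rho : representation) (B : A -> Prop) : Prop :=
  forall W : {pred V}, subrep rho B W -> exists W' : {pred V},
    [/\ subrep rho B W',
        forall v, v \in W -> v \in W' -> v = 0 &
        forall v, exists2 w, w \in W & v - w \in W'].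

End Representations.

Section Spectrum.
Variables (R : realType) (d n : nat).

(* The presentation is taken directly over C(q): extension of scalars from
   C[q, q^-1] keeps the generators and relations. *)
Definition Cq : fieldType := {fraction {poly R[i]}}.
Definition q : Cq := tofrac ('X : {poly R[i]}).

Local Notation Y := (YH q d n).
Local Notation t := (@YHt Cq q d n).
Local Notation g := (@YHg Cq q d n).
Local Notation J := (@JM Cq q d n).

Definition admissible (V : lmodType Cq) (rho : representation Y V) : Prop :=
  (forall i : 'I_n,
     diagonalisable (rho (t i)) /\ diagonalisable (rho (J i))) /\
  (forall i : 'I_n.-1,
     completely_reducible rho
       (generated_subalg
          [:: t (pos i); t (posS i); J (pos i); J (posS i); g i])).

(* An array has the a_i in its first row and the c_i in its second row. *)
Definition arr_a (L : 'M[Cq]_(2, n)) (i : 'I_n) : Cq := L ord0 i.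
Definition arr_c (L : 'M[Cq]_(2, n)) (i : 'I_n) : Cq := L ord_max i.

Definition Spec_JM : set 'M[Cq]_(2, n) :=
  [set L | exists (V : lmodType Cq) (rho : representation Y V) (v : V),
     [/\ admissible rho, v != 0 &
         forall i : 'I_n, rho (t i) v = arr_a L i *: v /\
                          rho (J i) v = arr_c L i *: v]]%classic.

Definition Cont : set 'M[Cq]_(2, n) :=
  [set L |
   let a := arr_a L in let c := arr_c L in
   [/\ (forall i : 'I_n, i = 0%N :> nat -> c i = 1) /\
       (forall i : 'I_n, a i ^+ d = 1),
       forall j : 'I_n, (0 < j)%N -> c j != 1 ->
         exists i : 'I_n, [/\ (i < j)%N, a i = a j &
           c i = c j * q ^- 2 \/ c i = c j * q ^+ 2] &
       forall j k : 'I_n, (j < k)%N -> a j = a k -> c j = c k ->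
         (3 <= k - j)%N /\
         exists i1 i2 : 'I_n,
           [/\ (j < i1 < k)%N /\ (j < i2 < k)%N,
               a i1 = a j /\ a i2 = a j,
               c i1 = c j * q ^- 2 & c i2 = c j * q ^+ 2]]]%classic.

End Spectrum.

Arguments Spec_JM : clear implicits.
Arguments Cont : clear implicits.

(* Main.v *)
Require Import Defs.
From mathcomp Require Import all_boot perm all_algebra.
From mathcomp Require Import boolp classical_sets reals complex.
From mathcomp Require Import zify ring.

Set Implicit Arguments.
Unset Strict Implicit.
Unset Printing Implicit Defensive.

Import GRing.Theory Num.Theory.
Local Open Scope ring_scope.

(** The argument is that of Okounkov and Vershik.  Fix a representation as in
    the definition of the spectrum and read an array as a word of length n
    whose letters are the pairs (a_i, c_i).  What matters is which words occur
    as joint eigenvalues of a nonzero vector of this one representation, and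
    how g_i acts on such a vector v.

    The elements J_k with k different from i and i+1 commute with g_i
    ([JM_far]), so everything happens in the span of v and g_i v, where the
    generators act by explicit formulas.  Call adjacent letters linked when
    a_i = a_{i+1} and c_{i+1} = q^2 c_i or q^-2 c_i.

    - Adjacent letters are distinct: otherwise v and g_i v would span a Jordan
      block of J_{i+1}, which is diagonalisable ([weight_repeat_neq]).
    - If they are not linked, a combination of g_i v and v is a nonzero vector
      for the word with these letters exchanged ([weight_swap]).
    - If they are linked, this combination spans a line stable under g_i.
      Complete reducibility forces it to vanish, so g_i v = q v or
      g_i v = - q^-1 v according to the sign ([weight_linked]).
    - Hence no word contains z, z', z with z' linked to z: the braid
      relation would make q equal to - q^-1 ([weight_no_braid]).

    The rest is combinatorics of words.  A letter with c_j <> 1 moves to the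
    left until it meets a letter linked to it, which must happen since the
    first letter has c_1 = 1 ([word_has_neighbour]).  Two equal letters move
    towards each other until the neighbours of both are linked to them; an
    induction on their distance then finds both linked letters between them
    ([word_repeat_surrounded]).  The two are different, as q^4 <> 1, which
    gives a distance of at least 3. *)

(** * Words closed under exchanges of unrelated adjacent letters *)

Definition swap_at (T : Type) (x : nat -> T) (i k : nat) : T :=
  if k == i then x i.+1 else if k == i.+1 then x i else x k.

Lemma swap_at_l (T : Type) (x : nat -> T) i : swap_at x i i = x i.+1.
Proof. by rewrite /swap_at eqxx. Qed.

Lemma swap_at_r (T : Type) (x : nat -> T) i : swap_at x i i.+1 = x i.
Proof. by rewrite /swap_at eqxx gtn_eqF. Qed.

Lemma swap_at_out (T : Type) (x : nat -> T) i k :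
  k != i -> k != i.+1 -> swap_at x i k = x k.
Proof. by rewrite /swap_at => /negPf-> /negPf->. Qed.

(** In the application, [S] consists of the words occurring in one
    representation, [up] and [dn] multiply the content of a letter by q^2 and
    q^-2, and the origin letters are those of content 1. *)
Section AdmissibleWords.
Variables (T : eqType) (up dn : T -> T) (origin : pred T) (n : nat).
Variable S : (nat -> T) -> Prop.
Hypotheses (upK : cancel up dn) (dnK : cancel dn up).
Hypothesis S_origin : forall x, S x -> origin (x 0).
Hypothesis S_neq : forall x i, S x -> (i.+1 < n)%N -> x i != x i.+1.
Hypothesis S_swap : forall x i, S x -> (i.+1 < n)%N ->
  x i.+1 != up (x i) -> x i.+1 != dn (x i) -> S (swap_at x i).
Hypothesis S_nobraid : forall x i, S x -> (i.+2 < n)%N -> x i.+2 = x i ->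
  x i.+1 = up (x i) \/ x i.+1 = dn (x i) -> False.

(** Move the letter to the left until a neighbour related to it blocks the way;
    without such a neighbour it would reach position 0, where only origin
    letters stand. *)
Lemma word_has_neighbour x j : S x -> (j < n)%N -> ~~ origin (x j) ->
  exists2 i, (i < j)%N & x i = up (x j) \/ x i = dn (x j).
Proof.
elim: j x => [|j IH] x Sx jn; first by rewrite S_origin.
case: (x j.+1 =P up (x j)) => [-> _|/eqP nup].
  by exists j; rewrite ?upK; auto.
case: (x j.+1 =P dn (x j)) => [-> _|/eqP ndn oj].
  by exists j; rewrite ?dnK; auto.
have := IH _ (S_swap Sx jn nup ndn) (ltnW jn).
rewrite swap_at_l => /(_ oj)[i ij]; rewrite swap_at_out; try lia.
by exists i => //; lia.
Qed.

Definition surrounded x j k :=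
  (exists2 i, (j < i < k)%N & x i = up (x j)) /\
  (exists2 i, (j < i < k)%N & x i = dn (x j)).

(** Induction on the distance: bring the two occurrences closer while an outer
    letter is not related to its inner neighbour.  Once both are blocked, two
    different blockers are the required letters, and two equal ones are
    themselves a closer pair. *)
Lemma word_repeat_surrounded x j k :
  S x -> (j < k)%N -> (k < n)%N -> x j = x k -> surrounded x j k.
Proof.
have [m] := ubnP (k - j); elim: m x j k => // m IH x j k km Sx jk kn xjk.
case: k jk kn km xjk => // k; rewrite ltnS leq_eqVlt => /predU1P[->|jk] kn km xjk.
  by case/negP: (S_neq Sx kn); rewrite xjk.
(* An outer letter unrelated to its inner neighbour is moved inwards. *)
have [kR|] := boolP ((x k.+1 == up (x k)) || (x k.+1 == dn (x k))); last first.
  rewrite negb_or => /andP[nup ndn].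
  have [|||||[i1 i1P]] := IH (swap_at x k) j k; rewrite ?swap_at_l //; try lia.
  - exact: S_swap.
  - by rewrite swap_at_out //; lia.
  rewrite !swap_at_out; try lia.
  move=> xi1 [i2 i2P]; rewrite swap_at_out; try lia.
  by move=> xi2; split; [exists i1|exists i2] => //; lia.
have [jR|] := boolP ((x j.+1 == up (x j)) || (x j.+1 == dn (x j))); last first.
  rewrite negb_or => /andP[nup ndn].
  have [|||||[i1 i1P]] := IH (swap_at x j) j.+1 k.+1; rewrite ?swap_at_r //; try lia.
  - by apply: S_swap => //; lia.
  - by rewrite swap_at_out //; lia.
  rewrite !swap_at_out; try lia.
  move=> xi1 [i2 i2P]; rewrite swap_at_out; try lia.
  by move=> xi2; split; [exists i1|exists i2] => //; lia.
have {}kR : x k = up (x j) \/ x k = dn (x j).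
  by rewrite xjk; case/orP: kR => /eqP->; rewrite ?upK ?dnK; auto.
have {}jR : x j.+1 = up (x j) \/ x j.+1 = dn (x j).
  by case/orP: jR => /eqP->; auto.
have jn : (j.+1 < k)%N.
  rewrite ltn_neqAle jk andbT; apply/eqP => ejk; rewrite -ejk in kn xjk.
  exact: (S_nobraid Sx kn).
(* If both inner neighbours are equal, the letter [x j] comes back between
   them, and this occurrence is closer to [j] than [k] is. *)
have closer i : (j.+1 < i < k)%N -> x i = x j -> surrounded x j k.+1.
  move=> iP xij; have [|||||[i1 i1P xi1] [i2 i2P xi2]] := IH x j i; rewrite ?xij //; try lia.
  by split; [exists i1|exists i2] => //; lia.
have inner : x j.+1 = x k -> surrounded x j.+1 k.
  by move=> e; apply: IH => //; lia.
have two i1 i2 : (j < i1 < k.+1)%N -> (j < i2 < k.+1)%N ->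
    x i1 = up (x j) -> x i2 = dn (x j) -> surrounded x j k.+1.
  by move=> ? ? ? ?; split; [exists i1|exists i2].
case: jR kR => xj [] xk.
- case: inner; rewrite ?xj ?xk // => _ [i iP]; rewrite upK.
  exact: closer.
- by apply: (two j.+1 k) => //; lia.
- by apply: (two k j.+1) => //; lia.
- case: inner; rewrite ?xj ?xk // => -[i iP]; rewrite dnK => xi _.
  exact: closer xi.
Qed.

End AdmissibleWords.

(** * Eigenvectors *)

Section Eigenvectors.
Variables (K : fieldType) (V : lmodType K) (f : {linear V -> V}).

(** Independence of eigenspaces, with coefficients [F] so that the induction
    can apply [f - p.1] to kill the head of the list while keeping its tail. *)
Lemma eigenvector_sum0 (s : seq (K * V)) (F : K * V -> K) c v :
  {in s, forall p, f p.2 = p.1 *: p.2 /\ p.1 != c} ->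
  f v = c *: v -> v = \sum_(p <- s) F p *: p.2 -> v = 0.
Proof.
elim: s F v => [|p s IH] F v fs fv; first by rewrite big_nil.
move=> ev; suff /eqP : (c - p.1) *: v = 0.
  have [_ pc] := fs p (mem_head _ _).
  by rewrite scaler_eq0 subr_eq0 eq_sym (negPf pc) => /eqP.
apply: (IH (fun r => F r * (r.1 - p.1))).
- by move=> r rs; apply: fs; rewrite inE rs orbT.
- by rewrite linearZ /= fv !scalerA mulrC.
rewrite scalerBl -fv {1 2}ev linear_sum /= scaler_sumr -sumrB big_cons.
have [fp _] := fs p (mem_head _ _).
rewrite linearZ /= fp !scalerA mulrC subrr add0r.
apply: eq_big_seq => r rs.
have [fr _] : f r.2 = r.1 *: r.2 /\ r.1 != c by apply: fs; rewrite inE rs orbT.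
by rewrite linearZ /= fr !scalerA -scalerBl mulrBr [p.1 * _]mulrC.
Qed.

(** Writing [x] as a sum of eigenvectors, [v = (f - c) x] loses its component of
    eigenvalue [c], yet is itself an eigenvector of eigenvalue [c]. *)
Lemma diagonalisable_no_jordan c v x :
  diagonalisable f -> f v = c *: v -> f x = c *: x + v -> v = 0.
Proof.
move=> /(_ x)[s fs ex] fv fx.
apply: (@eigenvector_sum0 [seq p <- s | p.1 != c] (fun p => p.1 - c) c) => //.
  by move=> p; rewrite mem_filter => /andP[pc ps]; split=> //; apply: fs.
rewrite -[LHS](addKr (c *: x)) -fx addrC {1 2}ex linear_sum /= scaler_sumr -sumrB.
rewrite big_filter [RHS]big_mkcond; apply: eq_big_seq => p ps /=.
by rewrite fs // -scalerBl; case: eqP => //= ->; rewrite subrr scale0r.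
Qed.

End Eigenvectors.

(** * Jucys-Murphy elements and the generators *)

Section JucysMurphy.
Variables (K : fieldType) (q : K) (d n : nat).
Local Notation g := (@YHg K q d n).
Local Notation J := (@JM K q d n).

(** For [k < i] only far commutations occur.  The braid relation is used once,
    for [k = i.+2]; beyond, the outer factors commute with [g i] again. *)
Lemma JM_far (i : 'I_n.-1) k : (k < n)%N -> k != i -> k != i.+1 ->
  GRing.comm (g i) (J k).
Proof.
have R := YH_gen_relations q d n.
have below (j : 'I_n.-1) m : (m < j)%N -> GRing.comm (g j) (J m).
  elim: m => [|m IH] mj; first exact: commr1.
  have mn : (m < n.-1)%N by have := ltn_ord j; lia.
  have gj : GRing.comm (g j) (g (Ordinal mn)).
    by apply: (YH_gC R) => /=; rewrite mj orbT.
  rewrite -[m.+1]/((Ordinal mn).+1) JM_S.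
  by do !apply: commrM => //; apply: IH; lia.
elim: k => [|k IH] kn ki kiS; first exact: commr1.
have [ik|] := ltnP i k.+1; last by move=> ?; apply: below; lia.
have kn' : (k < n.-1)%N by lia.
rewrite -[k.+1]/((Ordinal kn').+1) JM_S.
have [ik'|ik'] := ltnP i.+1 k.
  have gk : GRing.comm (g i) (g (Ordinal kn')) by apply: (YH_gC R); rewrite /= ik'.
  by do !apply: commrM => //; apply: IH; lia.
have {ik ik'} ek : k = i.+1 by lia.
set h := g (Ordinal kn').
have br : g i * h * g i = h * g i * h by apply: (YH_braid R).
have c : h * J i = J i * h by apply: below; rewrite /= ek.
rewrite /= ek JM_S; set a := g i in br *; set b := J i in c *.
transitivity (h * a * (h * b) * a * h); first by rewrite !mulrA br.
transitivity (h * a * b * (a * h * a)); last by rewrite !mulrA.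
by rewrite c br !mulrA.
Qed.

End JucysMurphy.

(** * Representations of an algebra *)

Section RepresentationTheory.
Variables (K : fieldType) (A : algType K) (V : lmodType K).
Variable rho : representation A V.

Lemma repD x y v : rho (x + y) v = rho x v + rho y v.
Proof. by have := act_linear rho 1 x y v; rewrite !scale1r. Qed.

Lemma rep0 v : rho 0 v = 0.
Proof. by apply: (@addrI _ (rho 0 v)); rewrite -repD !addr0. Qed.

Lemma repZ c x v : rho (c *: x) v = c *: rho x v.
Proof. by have := act_linear rho c x 0 v; rewrite rep0 !addr0. Qed.

Lemma rep_sum (I : Type) (r : seq I) (F : I -> A) v :
  rho (\sum_(i <- r) F i) v = \sum_(i <- r) rho (F i) v.
Proof. by apply: (big_morph (fun x => rho x v)) => [x y|]; rewrite ?rep0 ?repD. Qed.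

Lemma repX_eigen x c v k : rho x v = c *: v -> rho (x ^+ k) v = c ^+ k *: v.
Proof.
move=> xv; elim: k => [|k IH]; first by rewrite act1 scale1r.
by rewrite exprS actM IH linearZ /= xv scalerA -exprSr.
Qed.

Lemma generated_subalg_gen (s : seq A) x : x \in s -> generated_subalg s x.
Proof. by move=> xs B _; apply. Qed.

Definition line (w : V) : {pred V} := [pred u | `[< exists a, u = a *: w >]].

Lemma lineP w u : reflect (exists a, u = a *: w) (u \in line w).
Proof. exact: asboolP. Qed.

Lemma subrep_line (s : seq A) (w : V) :
  (forall x, x \in s -> exists b, rho x w = b *: w) ->
  subrep rho (generated_subalg s) (line w).
Proof.
move=> sw; split; first split.
- by apply/lineP; exists 0; rewrite scale0r.
- move=> a _ _ /lineP[b ->] /lineP[c ->]; apply/lineP.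
  by exists (a * b + c); rewrite scalerDl scalerA.
move=> x Bx _ /lineP[a ->].
have : x \in [pred y | `[< exists b, rho y w = b *: w >]].
  apply: Bx => [|y /sw yw]; last exact/asboolP.
  split.
  - by apply/asboolP; exists 1; rewrite act1 scale1r.
  - move=> e y z /asboolP[b yw] /asboolP[c zw]; apply/asboolP.
    by exists (e * b + c); rewrite act_linear yw zw scalerDl scalerA.
  - move=> y z /asboolP[b yw] /asboolP[c zw]; apply/asboolP.
    by exists (c * b); rewrite actM zw linearZ /= yw scalerA.
move=> /asboolP[b xw]; apply/lineP; exists (a * b).
by rewrite linearZ /= xw scalerA.
Qed.

Lemma subrep_scale B W c w : subrep rho B W -> w \in W -> c *: w \in W.
Proof.
by move=> [[W0 Wlin] _] wW; have := Wlin c _ _ wW W0; rewrite addr0.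
Qed.

Lemma subrep_sub B W u w : subrep rho B W -> u \in W -> w \in W -> u - w \in W.
Proof.
by move=> [[_ Wlin] _] uW wW; rewrite addrC -scaleN1r; apply: Wlin.
Qed.

(** The line of [w] has a stable complement [W'].  As [x] separates [v] from [w],
    the eigenvector [v] lies in [W']; then so does [w], which is obtained from
    [v] by [y] and scalars. *)
Lemma completely_reducible_no_extension (s : seq A) (x y : A) c c' v w :
  completely_reducible rho (generated_subalg s) ->
  x \in s -> y \in s -> c != c' ->
  (forall z, z \in s -> exists b, rho z w = b *: w) ->
  rho x v = c *: v -> rho x w = c' *: w ->
  (exists b, rho y v - b *: v = w) -> w = 0.
Proof.
move=> cr xs ys cc sw xv xw [b yv].
have [W' [subW' W0 dec]] := cr _ (subrep_line sw).
have wL e : e *: w \in line w by apply/lineP; exists e.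
have [_ /lineP[e ->] vW] := dec v.
have gen z : z \in s -> forall u, u \in W' -> rho z u \in W'.
  by move=> zs; apply: (proj2 subW'); exact: generated_subalg_gen.
have ew0 : e *: w = 0.
  have : (e * (c - c')) *: w = 0.
    apply: W0 => //.
    have := subrep_sub subW' (gen _ xs _ vW) (subrep_scale c subW' vW).
    rewrite linearB linearZ /= xv xw scalerBr opprB [_ + (_ - _)]addrC addrA.
    by rewrite subrK !scalerA -scalerBl mulrBr [c * e]mulrC.
  rewrite mulrC -scalerA => /eqP; rewrite scaler_eq0 subr_eq0 (negPf cc).
  by move/eqP.
rewrite ew0 subr0 in vW; apply: W0; first by rewrite -{1}[w]scale1r.
by rewrite -yv; apply: (subrep_sub subW'); [exact: gen|exact: (subrep_scale _ subW')].
Qed.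

End RepresentationTheory.

(** * Weights of the Yokonuma-Hecke algebra *)

Section Weights.
Variables (K : fieldType) (q : K) (d n : nat) (V : lmodType K).
Variable rho : representation (YH q d n) V.
Hypothesis dK : d%:R != 0 :> K.
Local Notation t := (@YHt K q d n).
Local Notation g := (@YHg K q d n).
Local Notation J := (@JM K q d n).

(** Words are functions on [nat] so that positions can be shifted freely; only
    the first [n] letters are constrained. *)
Definition weight (x : nat -> K * K) (v : V) : Prop :=
  v != 0 /\
  forall i : 'I_n, rho (t i) v = (x i).1 *: v /\ rho (J i) v = (x i).2 *: v.

Lemma weight_J x v k : weight x v -> (k < n)%N -> rho (J k) v = (x k).2 *: v.
Proof. by case=> _ xv kn; have [] := xv (Ordinal kn). Qed.

(** The quadratic relation reads [(g i - (q - q^-1) *: idem_e i) * g i = 1]. *)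
Lemma g_inj (i : 'I_n.-1) v : rho (g i) v = 0 -> v = 0.
Proof.
move=> gv0; have := congr1 (fun y => rho y v) (YH_gX2 (YH_gen_relations q d n) i).
by rewrite /= repD act1 repZ expr2 !actM gv0 !linear0 addr0 => <-.
Qed.

Lemma JM_inj k v : rho (J k) v = 0 -> v = 0.
Proof.
elim: k v => [|k IH] v; first by rewrite /= act1.
rewrite /=; case: insubP => [i _ _|_]; last by rewrite act1.
by rewrite !actM => /g_inj/IH/g_inj.
Qed.

Lemma weight_c_neq0 x v (i : 'I_n) : weight x v -> (x i).2 != 0.
Proof.
case=> v0 /(_ i)[_ Jv]; apply: contra_neq v0 => c0.
by apply: (@JM_inj i); rewrite Jv c0 scale0r.
Qed.

Lemma weight_a_root x v (i : 'I_n) : weight x v -> (x i).1 ^+ d = 1.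
Proof.
case=> v0 /(_ i)[tv _]; apply/eqP; rewrite -subr_eq0.
have := repX_eigen d tv; rewrite (YH_tX (YH_gen_relations q d n)) act1 => /eqP.
by rewrite eq_sym -subr_eq0 -{2}[v]scale1r -scalerBl scaler_eq0 (negPf v0) orbF.
Qed.

Lemma weight_origin x v (i : 'I_n) : i = 0%N :> nat -> weight x v -> (x i).2 = 1.
Proof.
move=> i0 [v0 /(_ i)[_]]; rewrite i0 /= act1 => /eqP.
by rewrite -subr_eq0 -{1}[v]scale1r -scalerBl scaler_eq0 (negPf v0) orbF subr_eq0 => /eqP.
Qed.

(** A sum of powers of the root of unity [a / b], written homogeneously: it is
    the cofactor of [b - a] in [b ^+ d - a ^+ d = 0]. *)
Lemma idem_e_eigen (i : 'I_n.-1) a b v :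
  a ^+ d = 1 -> b ^+ d = 1 ->
  rho (t (pos i)) v = a *: v -> rho (t (posS i)) v = b *: v ->
  rho (idem_e d t i) v = (a == b)%:R *: v.
Proof.
move=> ad bd ta tb; rewrite repZ rep_sum.
under eq_bigr do rewrite actM (repX_eigen _ tb) linearZ /= (repX_eigen _ ta) scalerA.
rewrite -scaler_suml scalerA; congr (_ *: _).
case: eqP => [->|/eqP ab] /=.
  under eq_bigr => s _ do rewrite -exprD subnK ?bd 1?ltnW //.
  by rewrite sumr_const card_ord mulVf.
apply/eqP; rewrite mulf_eq0; apply/orP; right.
have : (b - a) * (\sum_(s < d) b ^+ (d.-1 - s) * a ^+ s) = 0.
  by rewrite -subrXX ad bd subrr.
move/eqP; rewrite mulf_eq0 subr_eq0 eq_sym (negPf ab) /= => /eqP s0.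
rewrite -[X in _ == X](mulr0 b) -[X in b * X]s0 mulr_sumr.
apply/eqP; apply: eq_bigr => s _.
by rewrite mulrA -exprS; congr (_ ^+ _ * _); have := ltn_ord s; lia.
Qed.

Section LocalAnalysis.
Variables (x : nat -> K * K) (v : V) (i : 'I_n.-1).
Hypothesis xv : weight x v.
Local Notation gv := (rho (g i) v).
Local Notation a := (x i).1.
Local Notation b := (x i.+1).1.
Local Notation c := (x i).2.
Local Notation c' := (x i.+1).2.

(** The scalar by which [(q - q^-1) *: idem_e i] acts on [gv].  On the span of [v]
    and [gv] the generator [g i] satisfies the quadratic relation of the Hecke
    algebra when [a = b], and is an involution when [a != b]. *)
Definition hecke_step : K := (a == b)%:R * (q - q^-1).
Local Notation dl := hecke_step.

Lemma weight_t_g (j : 'I_n) : rho (t j) gv = (swap_at x i j).1 *: gv.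
Proof.
rewrite -actM (YH_tg (YH_gen_relations q d n)) actM.
have [_ /(_ (tperm (pos i) (posS i) j))[-> _]] := xv.
rewrite linearZ /= /swap_at; congr (_ *: _).
case: tpermP => [->|->|nj njS] /=; [by rewrite eqxx|by rewrite eqxx gtn_eqF|].
case: (nat_of_ord j =P i) => [e|_]; first by case: nj; apply: val_inj.
by case: (nat_of_ord j =P i.+1) => [e|//]; case: njS; apply: val_inj.
Qed.

Lemma weight_g2 : rho (g i) gv = v + dl *: gv.
Proof.
have R := YH_gen_relations q d n.
rewrite -actM -[g i * g i]/(g i ^+ 2) (YH_gX2 R) repD act1 repZ actM.
congr (_ + _).
have tw := weight_t_g.
have ra := @weight_a_root x v (pos i) xv; have rb := @weight_a_root x v (posS i) xv.
rewrite (@idem_e_eigen _ b a) // ?scalerA.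
- by rewrite mulrC /hecke_step eq_sym.
- by rewrite tw /= swap_at_l.
- by rewrite tw /= swap_at_r.
Qed.

Lemma weight_J_out (j : 'I_n) : j != i :> nat -> j != i.+1 :> nat ->
  rho (J j) gv = (x j).2 *: gv.
Proof.
move=> ji jiS; rewrite -actM -(JM_far q d (ltn_ord j) ji jiS) actM.
by have [_ /(_ j)[_ ->]] := xv; rewrite linearZ.
Qed.

Lemma weight_J_r : rho (J i.+1) gv = c *: gv + (dl * c') *: v.
Proof.
have Ji : rho (J i) v = c *: v := weight_J xv (ltn_ord (pos i)).
have JiS : rho (J i.+1) v = c' *: v := weight_J xv (ltn_ord (posS i)).
rewrite (JM_S q d i) !actM weight_g2 !(linearD, linearZ) /= Ji !linearZ /=.
by rewrite -scalerA -JiS (JM_S q d i) !actM.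
Qed.

Lemma weight_J_l : rho (J i) gv = c' *: (gv - dl *: v).
Proof.
have JiS : rho (J i.+1) v = c' *: v := weight_J xv (ltn_ord (posS i)).
apply/eqP; rewrite -subr_eq0; apply/eqP; apply: (@g_inj i).
have gK : rho (g i) (gv - dl *: v) = v.
  by rewrite linearB linearZ /= weight_g2 addrK.
by rewrite linearB linearZ /= gK -JiS (JM_S q d i) !actM subrr.
Qed.

(** The coefficient diagonalises the triangular action of [J i.+1] on [v], [gv].
    If [a != b] then [hecke_step = 0] and this is [gv], whatever the value of
    the quotient, in particular for [c = c']. *)
Definition intertwined : V := gv - (dl * c' / (c' - c)) *: v.

(** When [a = b] and [c = c'], formula [weight_J_r] puts [v] and [gv] in a Jordan
    block of [J i.+1], whose off-diagonal entry [hecke_step * c'] is nonzero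
    because [J i.+1] is injective. *)
Lemma weight_repeat_neq :
  q - q^-1 != 0 -> diagonalisable (rho (J i.+1)) -> a = b -> c != c'.
Proof.
move=> q1 diag ab; apply/eqP => cc.
have dl0 : dl * c' != 0.
  by rewrite mulf_neq0 ?(@weight_c_neq0 x v (posS i)) // /hecke_step ab eqxx mul1r.
have JiS : rho (J i.+1) v = c' *: v := weight_J xv (ltn_ord (posS i)).
have : (dl * c') *: v = 0.
  apply: (@diagonalisable_no_jordan _ _ (rho (J i.+1)) c' _ gv) => //.
    by rewrite linearZ /= JiS !scalerA mulrC.
  by rewrite weight_J_r cc.
by move/eqP; rewrite scaler_eq0 (negPf dl0) (negPf (proj1 xv)).
Qed.

(** If [v] is an eigenvector of [g i], its eigenvalue is governed by the quadratic
    relation, and [J i.+1 = g i * J i * g i] ties [c'] to [c]. *)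
Lemma weight_g_eigen k : gv = k *: v -> k ^+ 2 = 1 + dl * k /\ c' = k ^+ 2 * c.
Proof.
have v0 := proj1 xv => gk.
have inj y z : y *: v = z *: v -> y = z.
  by move/eqP; rewrite -subr_eq0 -scalerBl scaler_eq0 (negPf v0) orbF subr_eq0 => /eqP.
split; apply: inj.
  have := weight_g2; rewrite gk linearZ /= gk !scalerA -expr2 => ->.
  by rewrite scalerDl scale1r.
have Ji : rho (J i) v = c *: v := weight_J xv (ltn_ord (pos i)).
have JiS : rho (J i.+1) v = c' *: v := weight_J xv (ltn_ord (posS i)).
rewrite -JiS (JM_S q d i) !actM gk linearZ /= Ji !linearZ /= gk !scalerA.
by congr (_ *: _); ring.
Qed.

Section Intertwiner.
Hypothesis generic : c != c' \/ a != b.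

Lemma intertwined_coef : (dl * c' / (c' - c)) * (c' - c) = dl * c'.
Proof.
have [|ab] := boolP (c' == c); last by rewrite divfK // subr_eq0.
move/eqP => cc; case: generic; first by rewrite cc eqxx.
by rewrite /hecke_step => /negPf->; rewrite !mul0r.
Qed.

Lemma intertwined_t (j : 'I_n) :
  rho (t j) intertwined = (swap_at x i j).1 *: intertwined.
Proof.
have [_ /(_ j)[tv _]] := xv.
rewrite linearB linearZ /= weight_t_g tv scalerBr !scalerA; congr (_ - _ *: _).
have [ab|ab] := eqVneq a b; last by rewrite /hecke_step (negPf ab) !mul0r mulr0.
rewrite mulrC; congr (_ * _).
by rewrite /swap_at; do 2?case: eqP => [->|_] //; rewrite ab.
Qed.

Lemma intertwined_J (j : 'I_n) :
  rho (J j) intertwined = (swap_at x i j).2 *: intertwined.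
Proof.
have k := intertwined_coef; set kap := dl * c' / (c' - c) in k *.
rewrite linearB linearZ /=.
have [ji|ji] := eqVneq (j : nat) i.
  rewrite ji (weight_J xv (ltn_ord (pos i))) swap_at_l weight_J_l /intertwined -/kap !scalerBr !scalerA -addrA -opprD.
  rewrite -scalerDl; congr (_ - _ *: _).
  by rewrite [c' * dl]mulrC -k; ring.
have [jiS|jiS] := eqVneq (j : nat) i.+1.
  rewrite jiS (weight_J xv (ltn_ord (posS i))) swap_at_r weight_J_r /intertwined -/kap scalerBr !scalerA -addrA -k.
  by rewrite -scalerBl -scaleNr; congr (_ + _ *: _); ring.
by rewrite (weight_J xv (ltn_ord j)) weight_J_out // swap_at_out // /intertwined -/kap scalerBr !scalerA mulrC.
Qed.


(** The intertwined vector can only vanish if [v] is an eigenvector of [g i]; by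
    [weight_g_eigen] the eigenvalue is then [q] or [- q^-1] and the letters are
    linked. *)
Lemma weight_swap :
  q != 0 -> ~ (a = b /\ (c' = q ^+ 2 * c \/ c' = q ^- 2 * c)) ->
  weight (swap_at x i) intertwined.
Proof.
move=> q0 unlinked; split=> [|j]; last by split; [exact: intertwined_t|exact: intertwined_J].
apply/eqP => /eqP; rewrite subr_eq0 => /eqP.
set k := _ / _ => gk; have [k2 ck] := weight_g_eigen gk.
have [ab|ab] := eqVneq a b; last first.
  have k0 : k = 0 by rewrite /k /hecke_step (negPf ab) !mul0r.
  by move/eqP: k2; rewrite k0 mulr0 addr0 expr0n eq_sym oner_eq0.
case: unlinked; split=> //.
have : (k - q) * (k + q^-1) = 0.
  transitivity (k ^+ 2 - 1 - (q - q^-1) * k); first by field.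
  by rewrite k2 /hecke_step ab eqxx mul1r; ring.
move/eqP; rewrite mulf_eq0 subr_eq0 addr_eq0 ck => /orP[] /eqP->; first by left.
by right; rewrite sqrrN exprVn.
Qed.

End Intertwiner.

(** Under these hypotheses the intertwined vector is [gv - k *: v], and the
    quadratic relation makes it an eigenvector of [g i].  So it spans a line
    stable under the local subalgebra, on which [J i] has the eigenvalue
    [c' <> c]: [v] would be a nonsplit extension unless that vector is 0. *)
Lemma weight_linked k :
  completely_reducible rho
    (generated_subalg [:: t (pos i); t (posS i); J (pos i); J (posS i); g i]) ->
  a = b -> k ^+ 2 = 1 + (q - q^-1) * k -> k ^+ 2 != 1 -> c' = k ^+ 2 * c ->
  gv = k *: v.
Proof.
move=> cr ab k2 k1 ck.
have dlE : dl = q - q^-1 by rewrite /hecke_step ab eqxx mul1r.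
have c0 : c != 0 := weight_c_neq0 (pos i) xv.
have cc : c != c' by apply: contraNneq k1; rewrite ck -{1}[c]mul1r => /(mulIf c0) ->.
have gen : c != c' \/ a != b by left.
have coefE : dl * c' / (c' - c) = k.
  have cc' : c' - c != 0 by rewrite subr_eq0 eq_sym.
  by apply: (mulIf cc'); rewrite divfK // ck dlE k2; ring: k2.
have wE : intertwined = gv - k *: v by rewrite /intertwined coefE.
have gw : rho (g i) intertwined = (dl - k) *: intertwined.
  rewrite wE linearB linearZ /= weight_g2 scalerBr scalerA.
  have -> : (dl - k) * k = -1 by rewrite mulrBl -expr2 k2 dlE; ring.
  by rewrite scaleN1r opprK scalerBl -addrA addrC.
have w0 : intertwined = 0.
  apply: (completely_reducible_no_extension cr (x := J i) (y := g i)
    (c := c) (c' := c') (v := v)) => //.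
  - by rewrite !inE eqxx !orbT.
  - by rewrite !inE eqxx !orbT.
  - move=> z; rewrite !inE => /or4P[/eqP->|/eqP->|/eqP->|/orP[/eqP->|/eqP->]].
    + by eexists; exact: intertwined_t.
    + by eexists; exact: intertwined_t.
    + by eexists; exact: (intertwined_J gen).
    + by eexists; exact: (intertwined_J gen).
    + by eexists; exact: gw.
  - exact: (weight_J xv (ltn_ord (pos i))).
  - by rewrite (intertwined_J gen (pos i)) swap_at_l.
  - by exists k.
by apply/eqP; rewrite -subr_eq0 -wE w0.
Qed.

End LocalAnalysis.

(** The braid relation applied to [v] reads [k ^+ 2 * k' = k * k' ^+ 2]. *)
Lemma weight_no_braid x v (i j : 'I_n.-1) k k' : j = i.+1 :> nat ->
  weight x v -> rho (g i) v = k *: v -> rho (g j) v = k' *: v -> k = k'.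
Proof.
move=> ij xv gi gj.
have knz (m : 'I_n.-1) b : rho (g m) v = b *: v -> b != 0.
  move=> gm; apply: contra_neq (proj1 xv) => b0.
  by apply: (@g_inj m); rewrite gm b0 scale0r.
have := congr1 (fun y => rho y v) (YH_braid (YH_gen_relations q d n) ij).
rewrite /= !actM; do 6?rewrite ?gi ?gj ?linearZ /=.
rewrite !scalerA => /eqP; rewrite -subr_eq0 -scalerBl scaler_eq0 (negPf (proj1 xv)) orbF.
rewrite subr_eq0 => /eqP e; apply: (mulfI (mulf_neq0 (knz _ _ gi) (knz _ _ gj))).
by ring: e.
Qed.

End Weights.

(** * Words of contents *)

Section Content.
Variables (K : fieldType) (q : K) (d n : nat) (V : lmodType K).
Variable rho : representation (YH q d n) V.
Local Notation t := (@YHt K q d n).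
Local Notation g := (@YHg K q d n).
Local Notation J := (@JM K q d n).
Hypotheses (dK : d%:R != 0 :> K) (q0 : q != 0) (q4 : q ^+ 4 != 1).
Hypothesis J_diag : forall i : 'I_n, diagonalisable (rho (J i)).
Hypothesis cr : forall i : 'I_n.-1, completely_reducible rho
  (generated_subalg [:: t (pos i); t (posS i); J (pos i); J (posS i); g i]).

Definition content_up (z : K * K) : K * K := (z.1, q ^+ 2 * z.2).
Definition content_dn (z : K * K) : K * K := (z.1, q ^- 2 * z.2).
Definition occurs (x : nat -> K * K) : Prop := exists v, weight rho x v.

Lemma content_upK : cancel content_up content_dn.
Proof. by case=> a c; rewrite /content_dn /= mulKf // expf_neq0. Qed.

Lemma content_dnK : cancel content_dn content_up.
Proof. by case=> a c; rewrite /content_up /= mulVKf // expf_neq0. Qed.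

Lemma q2_neq1 : q ^+ 2 != 1.
Proof. by apply: contraNneq q4 => q2; rewrite (exprM q 2 2) q2 expr1n. Qed.

Lemma q2_neqN1 : q ^+ 2 != -1.
Proof. by apply: contraNneq q4 => q2; rewrite (exprM q 2 2) q2 sqrrN expr1n. Qed.

(** Equality would give [content_up (content_up z) = z], hence [q ^+ 4 = 1]. *)
Lemma content_up_neq_dn z : z.2 != 0 -> content_up z != content_dn z.
Proof.
move=> z0; apply: contra_neq q4 => /(congr1 content_up); rewrite content_dnK.
case: z z0 => a c /= c0 []; rewrite mulrA -exprD => e.
by apply: (mulIf c0); rewrite mul1r.
Qed.

Lemma occurs_neq x i : occurs x -> (i.+1 < n)%N -> x i != x i.+1.
Proof.
case=> v xv iN; have iN' : (i < n.-1)%N by lia.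
apply/eqP => e; have := @weight_repeat_neq _ _ _ _ _ _ dK _ _ (Ordinal iN') xv.
rewrite /= e eqxx => W.
have /W : q - q^-1 != 0.
  by rewrite subr_eq0; apply: contra_neq q2_neq1 => qV; rewrite expr2 {2}qV divff.
by move=> /(_ (J_diag (posS (Ordinal iN'))) erefl).
Qed.

Lemma occurs_swap x i : occurs x -> (i.+1 < n)%N ->
  x i.+1 != content_up (x i) -> x i.+1 != content_dn (x i) ->
  occurs (swap_at x i).
Proof.
move=> xo iN nup ndn; have neq := occurs_neq xo iN.
case: xo => v xv; have iN' : (i < n.-1)%N by lia.
exists (intertwined rho x v (Ordinal iN')).
apply: (weight_swap dK xv) => //=.
  by move: neq; rewrite -pair_eqE negb_and => /orP[]; auto.
case=> [ab [] ck]; [case/eqP: nup|case/eqP: ndn];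
  by rewrite /content_up /content_dn ab -ck; case: (x i.+1).
Qed.

Lemma weight_up_eigen x v (i : 'I_n.-1) : weight rho x v ->
  x i.+1 = content_up (x i) -> rho (g i) v = q *: v.
Proof.
move=> xv e; apply: (weight_linked dK xv (@cr i)); rewrite ?e ?q2_neq1 //.
by rewrite mulrBl mulVf // -expr2 addrC subrK.
Qed.

Lemma weight_dn_eigen x v (i : 'I_n.-1) : weight rho x v ->
  x i.+1 = content_dn (x i) -> rho (g i) v = (- q^-1) *: v.
Proof.
move=> xv e; apply: (weight_linked dK xv (@cr i)); rewrite ?e //.
- by field.
- by rewrite sqrrN exprVn invr_eq1 q2_neq1.
- by rewrite sqrrN exprVn.
Qed.

Lemma occurs_no_braid x i : occurs x -> (i.+2 < n)%N -> x i.+2 = x i ->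
  x i.+1 = content_up (x i) \/ x i.+1 = content_dn (x i) -> False.
Proof.
case=> v xv iN e.
have iN1 : (i < n.-1)%N by lia.
have iN2 : (i.+1 < n.-1)%N by lia.
have ne : q = - q^-1 -> False.
  by move=> qV; case/eqP: q2_neqN1; rewrite expr2 {2}qV mulrN divff.
have nb := @weight_no_braid _ _ _ _ _ rho _ _ (Ordinal iN1) (Ordinal iN2) _ _ erefl xv.
case=> h.
- apply: ne; apply: nb; first exact: (weight_up_eigen (i := Ordinal iN1) xv h).
  by apply: (weight_dn_eigen xv); rewrite /= e h content_upK.
- apply: ne; apply/esym; apply: nb; first exact: (weight_dn_eigen (i := Ordinal iN1) xv h).
  by apply: (weight_up_eigen xv); rewrite /= e h content_dnK.
Qed.

Lemma occurs_origin x : (0 < n)%N -> occurs x -> (x 0).2 == 1.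
Proof. by move=> n0 [v /(weight_origin (i := Ordinal n0) erefl) /= ->]. Qed.

Lemma occurs_neighbour x j : occurs x -> (j < n)%N -> (x j).2 != 1 ->
  exists2 i, (i < j)%N & x i = content_up (x j) \/ x i = content_dn (x j).
Proof.
move=> xo jn; apply: (word_has_neighbour (origin := [pred z | z.2 == 1])
  content_upK content_dnK _ occurs_swap xo jn).
by move=> y yo; apply: occurs_origin yo; lia.
Qed.

Lemma occurs_repeat x j k : occurs x -> (j < k)%N -> (k < n)%N -> x j = x k ->
  surrounded content_up content_dn x j k.
Proof.
exact: (word_repeat_surrounded content_upK content_dnK occurs_neq occurs_swap occurs_no_braid).
Qed.

End Content.

(** * The spectrum over the field of rational functions *)

Lemma Cq_natr_neq0 (R : realType) m : (0 < m)%N -> m%:R != 0 :> Cq R.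
Proof.
move=> m0; rewrite -(rmorph_nat (@tofrac {poly R[i]})) tofrac_eq0.
by rewrite -polyC_natr polyC_eq0 pnatr_eq0 -lt0n.
Qed.

Lemma q_neq0 (R : realType) : q R != 0.
Proof. by rewrite /q tofrac_eq0 polyX_eq0. Qed.

Lemma q4_neq1 (R : realType) : q R ^+ 4 != 1.
Proof.
rewrite /q -rmorphXn -(rmorph1 (@tofrac {poly R[i]})) -subr_eq0 -rmorphB tofrac_eq0.
by rewrite -size_poly_eq0 size_XnsubC.
Qed.

Theorem proposition3 (R : realType) (d n : nat)
  (hd : (1 <= d)%N) (hn : (1 <= n)%N) :
  (Spec_JM R d n `<=` Cont R d n)%classic.
Proof.
move=> L [V [rho [v [[diag cr] v0 Lv]]]].
have dK := Cq_natr_neq0 R hd; have q0 := q_neq0 R; have q4 := q4_neq1 R.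
have Jdiag (i : 'I_n) := (diag i).2.
pose x (k : nat) : Cq R * Cq R :=
  if insub k is Some i then (arr_a L i, arr_c L i) else (0, 0).
have xE (i : 'I_n) : x i = (arr_a L i, arr_c L i) by rewrite /x valK.
have xw : weight rho x v by split=> // i; rewrite xE; exact: Lv.
have xo : occurs rho x by exists v.
split; first split.
- by move=> i i0; have := weight_origin i0 xw; rewrite xE.
- by move=> i; have := weight_a_root i xw; rewrite xE.
- move=> j _ cj; have := @occurs_neighbour _ _ _ _ _ _ dK q0 q4 Jdiag x j xo (ltn_ord j).
  rewrite xE => /(_ cj)[i ij]; have iN := ltn_trans ij (ltn_ord j).
  have /= -> := xE (Ordinal iN) => e.
  exists (Ordinal iN); rewrite ![arr_c L j * _]mulrC.
  by case: e => -[-> ->]; split; auto.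
move=> j k jk a_eq c_eq.
have xjk : x j = x k by rewrite !xE a_eq c_eq.
have [[i2 i2P e2] [i1 i1P e1]] :=
  occurs_repeat dK q0 q4 Jdiag cr xo jk (ltn_ord k) xjk.
rewrite xjk in e1 e2.
have i1N : (i1 < n)%N by have := ltn_ord k; lia.
have i2N : (i2 < n)%N by have := ltn_ord k; lia.
have i12 : i1 != i2.
  apply/eqP => i12; case/eqP: (content_up_neq_dn q0 q4 (weight_c_neq0 k xw)).
  by rewrite -e2 -e1 i12.
rewrite xE in e1 e2; move: e1 e2; have /= -> := xE (Ordinal i1N); have /= -> := xE (Ordinal i2N).
rewrite /content_up /content_dn /= => -[a1 c1] [a2 c2].
split; first by lia.
by exists (Ordinal i1N), (Ordinal i2N); rewrite a_eq c_eq ![arr_c L k * _]mulrC; split.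
Qed.
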